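(* Let $B$ be a finite left brace with $|B|>1$ and $\mathrm{Soc}(B)=\{0\}$, and let $X\subseteq B$ be a transitive cycle base of $B$, regarded as a cycle set with the operation $x\cdot y:=\lambda_x^{-1}(y)$ for $x,y\in X$. Then the following conditions are equivalent: 1) $X$ is a simple cycle set; 2) every non-trivial ideal of $B$ (i.e. every ideal different from $\{0\}$, including $B$ itself) acts transitively on $X$; 3) $B$ has a unique minimal ideal $I$, and $I$ acts transitively on $X$.
   Context: A left brace is a set $B$ with two operations $+$ and $\circ$ such that $(B,+)$ is an abelian group, $(B,\circ)$ is a group, and $a\circ(b+c)+a=a\circ b+a\circ c$ for all $a,b,c\in B$. The identity elements of the two groups coincide and are denoted $0$. For $a\in B$ put $\lambda_a(b):=-a+a\circ b$. Then $\lambda_a\in\mathrm{Aut}(B,+)$ and $a\mapsto\lambda_a$ is a group homomorphism from $(B,\circ)$ to $\mathrm{Aut}(B,+)$, so $(B,\circ)$ acts on $B$ via $\lambda$. The socle is $\mathrm{Soc}(B)=\{a\in B : a+b=a\circ b \text{ for all } b\in B\}=\{a\in B:\lambda_a=\mathrm{id}_B\}$. An ideal of $B$ is a normal subgroup $I$ of $(B,\circ)$ such that $\lambda_a(I)\subseteq I$ for every $a\in B$. The trivial ideal is $\{0\}$. A minimal ideal is a non-trivial ideal that is minimal with respect to inclusion among the non-trivial ideals. A transitive cycle base of $B$ is a subset $X\subseteq B$ that is a single orbit of the action $\lambda$ of $(B,\circ)$ on $B$ and that generates the additive group $(B,+)$. An ideal $I$ acts on $X$ by restricting the action $\lambda$;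 it acts transitively on $X$ if for all $x,y\in X$ there is $a\in I$ with $\lambda_a(x)=y$. A cycle set is a non-empty set $X$ with a binary operation $\cdot$ such that each left multiplication $\sigma_x:X\to X$, $y\mapsto x\cdot y$, is bijective and $(x\cdot y)\cdot(x\cdot z)=(y\cdot x)\cdot(y\cdot z)$ for all $x,y,z\in X$. It is non-degenerate if $x\mapsto x\cdot x$ is bijective. All cycle sets are assumed to be finite and non-degenerate. The operation $a\cdot b:=\lambda_a^{-1}(b)$ makes $B$ a cycle set, and it restricts to a cycle set operation on every transitive cycle base $X$. A homomorphism of cycle sets is a map $f$ with $f(x\cdot y)=f(x)\cdot f(y)$; an epimorphism is a surjective homomorphism, an isomorphism is a bijective homomorphism. A cycle set $X$ is simple if $|X|>1$ and for every epimorphism $f$ from $X$ to a cycle set $Y$, either $|Y|=1$ or $f$ is an isomorphism. *)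

(* Defs.v *)
From HB Require Import structures.
From mathcomp Require Import all_boot all_order all_algebra all_fingroup.

Set Implicit Arguments.
Unset Strict Implicit.
Unset Printing Implicit Defensive.

Import GRing.Theory.
Local Open Scope ring_scope.

(* The identity [circ1] of the group (B, circ) is not assumed to be 0; this is *)
(* derived in [circ1E].                                                        *)
HB.mixin Record Zmodule_isLeftBrace B of GRing.Zmodule B := {
  circ : B -> B -> B;
  circ1 : B;
  circV : B -> B;
  circA : associative circ;
  circ1x : left_id circ1 circ;
  circVx : left_inverse circ1 circV circ;
  circ_addr : forall a b c : B, circ a (b + c) + a = circ a b + circ a c
}.

#[short(type="leftBraceType")]
HB.structure Definition LeftBrace :=
  {B of GRing.Zmodule B & Zmodule_isLeftBrace B}.

#[short(type="finLeftBraceType")]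
HB.structure Definition FinLeftBrace := {B of LeftBrace B & Finite B}.

(* MathComp already equips the finZmodType B with the group structure (B, +);  *)
(* this copy of B carries the group structure (B, circ).                       *)
Definition circ_group (B : finLeftBraceType) : Type := B.
HB.instance Definition _ (B : finLeftBraceType) := Finite.on (circ_group B).
HB.instance Definition _ (B : finLeftBraceType) :=
  Finite_isGroup.Build (circ_group B) (@circA B) (@circ1x B) (@circVx B).

Definition lambda (B : leftBraceType) (a b : B) : B := - a + circ a b.

Section LambdaTheory.

Variable B : finLeftBraceType.
Implicit Types a b c : B.

Lemma circ_lambda a b : circ a b = a + lambda a b.
Proof. by rewrite /lambda addNKr. Qed.

Lemma lambdaD a : {morph lambda a : b c / b + c}.
Proof.
move=> b c; rewrite /lambda -[circ a (b + c)](addrK a) circ_addr.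
by rewrite -addrA [circ a c - a]addrC addrA.
Qed.

Lemma lambda0 a : lambda a 0 = 0.
Proof. by apply: (addrI (lambda a 0)); rewrite -lambdaD !addr0. Qed.

Lemma circx0 a : circ a 0 = a.
Proof. by rewrite circ_lambda lambda0 addr0. Qed.

Lemma circ1E : circ1 = 0 :> B.
Proof. by rewrite -[LHS]circx0 circ1x. Qed.

Lemma circ0x a : circ 0 a = a.
Proof. by rewrite -circ1E circ1x. Qed.

Lemma circxV a : circ a (circV a) = 0.
Proof. by rewrite -circ1E; exact: (@mulgV (circ_group B) a). Qed.

Lemma lambda_circ a b c : lambda (circ a b) c = lambda a (lambda b c).
Proof.
apply: (addrI (circ a b)); rewrite -circ_lambda -circA (circ_lambda b).
by rewrite (circ_lambda a) lambdaD addrA -circ_lambda.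
Qed.

Lemma lambda_id b : lambda 0 b = b.
Proof. by rewrite /lambda circ0x oppr0 add0r. Qed.

Lemma lambda_inj a : injective (lambda a).
Proof.
apply: (can_inj (g := lambda (circV a))) => b.
by rewrite -lambda_circ circVx circ1E lambda_id.
Qed.

End LambdaTheory.

Definition socle (B : finLeftBraceType) : {set B} :=
  [set a | [forall b, a + b == circ a b]].

Definition is_ideal (B : finLeftBraceType) (I : {set circ_group B}) : bool :=
  [&& group_set I, (I <| [set: circ_group B])%g
    & [forall a : B, lambda a @: I \subset I]].

Definition is_minimal_ideal (B : finLeftBraceType) (I : {set B}) : bool :=
  minset (fun J : {set B} => is_ideal J && (J != [set 0])) I.

Definition transitive_cycle_base (B : finLeftBraceType) (X : {set B}) : bool :=
  [exists x, X == [set lambda a x | a : B]]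
  && (<<X : {set (B : finZmodType)}>>%g == [set: B]).

Definition acts_transitively (B : finLeftBraceType) (I X : {set B}) : Prop :=
  forall x y, x \in X -> y \in X -> exists2 a, a \in I & lambda a x = y.

(* Cycle sets are finite and non-degenerate by convention. *)
HB.mixin Record Finite_isCycleSet X of Finite X := {
  cdot : X -> X -> X;
  cycle_set_gt0 : (0 < #|{: X}|)%N;
  cdot_bij : forall x, bijective (cdot x);
  cdotA : forall x y z,
    cdot (cdot x y) (cdot x z) = cdot (cdot y x) (cdot y z);
  cdot_nondeg : bijective (fun x => cdot x x)
}.

#[short(type="cycleSetType")]
HB.structure Definition CycleSet := {X of Finite X & Finite_isCycleSet X}.

Definition cycle_set_morphism (X Y : cycleSetType) (f : X -> Y) : Prop :=
  {morph f : x y / cdot x y}.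

Definition simple_cycle_set (X : cycleSetType) : Prop :=
  (1 < #|X|)%N /\
  forall (Y : cycleSetType) (f : X -> Y),
    cycle_set_morphism f -> (forall y, exists x, f x = y) ->
    #|Y| = 1%N \/ bijective f.

Definition lambda_inv (B : finLeftBraceType) (a : B) : B -> B :=
  invF (@lambda_inj B a).

Section CycleBase.

Variables (B : finLeftBraceType) (X : {set B}).
Hypothesis cbX : transitive_cycle_base X.

Lemma lambda_invE (a b : B) : lambda_inv a b = lambda (circV a) b.
Proof.
apply: (@lambda_inj B a); rewrite /lambda_inv f_invF.
by rewrite -lambda_circ circxV lambda_id.
Qed.

Lemma lambda_inv_cycle_base (a b : B) : b \in X -> lambda_inv a b \in X.
Proof.
case/andP: cbX => /existsP[x /eqP->] _ /imsetP[c _ ->].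
by apply/imsetP; exists (circ (circV a) c); rewrite // lambda_circ lambda_invE.
Qed.

(* The carrier depends on the proof [cbX] so that the cycle set structure can  *)
(* be inferred from it.                                                        *)
Definition cycle_base_type of transitive_cycle_base X : Type := {x : B | x \in X}.

Local Notation T := (cycle_base_type cbX).
HB.instance Definition _ := SubFinite.on T.

Definition cycle_base_dot (x y : T) : T :=
  exist _ (lambda_inv (val x) (val y))
        (lambda_inv_cycle_base (val x) (valP y)).

Lemma cycle_base_gt0 : (0 < #|{: T}|)%N.
Proof.
case/andP: (cbX) => /existsP[x /eqP eX] _.
have xX : x \in X by rewrite eX; apply/imsetP; exists 0; rewrite ?lambda_id.
by apply/card_gt0P; exists (exist _ x xX : T).
Qed.

Lemma cycle_base_dot_bij x : bijective (cycle_base_dot x).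
Proof.
apply: injF_bij => y z /(congr1 val) /= e; apply: val_inj.
by rewrite -(f_invF (@lambda_inj B (val x)) (val y)) -/(lambda_inv _ _) e f_invF.
Qed.

Lemma cycle_base_dotA x y z :
  cycle_base_dot (cycle_base_dot x y) (cycle_base_dot x z) =
  cycle_base_dot (cycle_base_dot y x) (cycle_base_dot y z).
Proof.
have key (a b c : B) : lambda (a + b) (lambda_inv (lambda_inv a b)
    (lambda_inv a c)) = c.
  rewrite -{1}[b](f_invF (@lambda_inj B a)) -circ_lambda lambda_circ.
  by rewrite /lambda_inv !f_invF.
apply: val_inj; apply: (@lambda_inj B (val x + val y)).
by rewrite /= key addrC key.
Qed.

Lemma cycle_base_dot_nondeg : bijective (fun x => cycle_base_dot x x).
Proof.
have key (a : B) : lambda_inv a a = - circV a.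
  apply: (@lambda_inj B a); rewrite /lambda_inv f_invF.
  by apply: (addIr (lambda a (circV a))); rewrite -lambdaD addNr -circ_lambda
    circxV lambda0.
apply: injF_bij => x y /(congr1 val) /=; rewrite !key => /oppr_inj e.
by apply: val_inj; exact: (@invg_inj (circ_group B) _ _ e).
Qed.

HB.instance Definition _ :=
  Finite_isCycleSet.Build T cycle_base_gt0 cycle_base_dot_bij
    cycle_base_dotA cycle_base_dot_nondeg.

End CycleBase.

(* Main.v *)
Require Import Defs.
From HB Require Import structures.
From mathcomp Require Import all_boot all_order all_algebra all_fingroup.
From mathcomp Require Import generic_quotient.

Set Implicit Arguments.
Unset Strict Implicit.
Unset Printing Implicit Defensive.

Import GRing.Theory.
Local Open Scope ring_scope.
Local Open Scope quotient_scope.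

(** The proof is a dictionary between non-trivial ideals of B and proper
    quotients of the cycle set X.

    From ideals to quotients: the orbits on X of an ideal I form a congruence
    of the cycle set ([ideal_orbit_cdot]), because X moves under I only inside
    the additive cosets of I, and such a coset is also a coset for circ.  If X
    is simple, this congruence is total, so that I is transitive, or it is the
    equality; then I fixes the additive generators X, hence acts trivially on
    B and lies in the socle, which is 0.

    From quotients to ideals: let f : X -> Y be an epimorphism.  Since X also
    generates (B, circ), the action of B on X respects the fibres of f, and so
    B acts on Y.  The kernel K of this action is an ideal; the point is its
    invariance under lambda ([morphism_kernel_lambdaV]), which follows by
    writing the sum x + a in two ways as a circ product.  If K is not 0, then
    it is transitive on X and preserves every fibre, so f is constant.  If
    K = 0, then f is injective: when f s = f t, the elements s and t act in the
    same way on Y, so s circ t^-1 lies in K.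

    Uniqueness of the minimal ideal: x and lambda_a x differ by an element of
    I whenever a is in I.  If I and J are both transitive on X and meet in 0,
    then any two points of X differ by an element of their intersection, so X
    is a point, lambda is trivial on the generators, and the socle is B.
    Conversely every non-trivial ideal contains a minimal one, and inherits
    its transitivity. *)

(** * Quotients of cycle sets by congruences *)

Section Congruence.

Variables (X : cycleSetType) (e : equiv_rel X).
Hypothesis cdot_e : forall x x' y y',
  e x x' -> e y y' -> e (cdot x y) (cdot x' y').

(** The type depends on the proof that [e] is compatible with the operation, so
    that its cycle set structure can be inferred. *)
Definition congruence_quotient of (forall x x' y y',
  e x x' -> e y y' -> e (cdot x y) (cdot x' y')) : Type := {eq_quot e}.

Local Notation Q := (congruence_quotient cdot_e).

HB.instance Definition _ := Choice.copy Q {eq_quot e}.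
HB.instance Definition _ : isCountable Q :=
  CanIsCountable (reprK : cancel (repr : {eq_quot e} -> X) \pi_({eq_quot e})).
HB.instance Definition _ : isFinite Q :=
  CanIsFinite (reprK : cancel (repr : {eq_quot e} -> X) \pi_({eq_quot e})).

Definition quotient_proj (x : X) : Q := \pi_({eq_quot e}) x.
Definition quotient_repr (u : Q) : X := repr (u : {eq_quot e}).

Lemma quotient_reprK : cancel quotient_repr quotient_proj.
Proof. by move=> u; exact: reprK. Qed.

Lemma quotient_projE x y : (quotient_proj x = quotient_proj y) <-> e x y.
Proof. by rewrite /quotient_proj; split=> [/eqmodP|h]; last exact/eqmodP. Qed.

Definition quotient_dot (u v : Q) : Q :=
  quotient_proj (cdot (quotient_repr u) (quotient_repr v)).

Lemma quotient_dotE x y :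
  quotient_dot (quotient_proj x) (quotient_proj y) = quotient_proj (cdot x y).
Proof.
by apply/quotient_projE/cdot_e; apply/quotient_projE; rewrite quotient_reprK.
Qed.

Lemma quotient_gt0 : (0 < #|{: Q}|)%N.
Proof.
case/card_gt0P: (cycle_set_gt0 (s := X)) => x _.
by apply/card_gt0P; exists (quotient_proj x).
Qed.

(** By finiteness: a map induced by a bijection is surjective on the quotient. *)
Lemma quotient_surj_bij (h : Q -> Q) (g : X -> X) : bijective g ->
  (forall x, h (quotient_proj x) = quotient_proj (g x)) -> bijective h.
Proof.
case=> g' _ gK hE.
have hK : cancel (fun u => quotient_proj (g' (quotient_repr u))) h.
  by move=> u; rewrite hE gK quotient_reprK.
by apply: (bij_can_bij _ hK); apply: injF_bij; exact: can_inj hK.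
Qed.

Lemma quotient_dot_bij u : bijective (quotient_dot u).
Proof.
apply: (quotient_surj_bij (cdot_bij (quotient_repr u))) => x.
by rewrite -{1}(quotient_reprK u) quotient_dotE.
Qed.

Lemma quotient_dotA u v w :
  quotient_dot (quotient_dot u v) (quotient_dot u w) =
  quotient_dot (quotient_dot v u) (quotient_dot v w).
Proof.
rewrite -(quotient_reprK u) -(quotient_reprK v) -(quotient_reprK w).
by rewrite !quotient_dotE cdotA.
Qed.

Lemma quotient_dot_nondeg : bijective (fun u => quotient_dot u u).
Proof.
by apply: (quotient_surj_bij (cdot_nondeg (s := X))) => x; rewrite quotient_dotE.
Qed.

HB.instance Definition _ :=
  Finite_isCycleSet.Build Q quotient_gt0 quotient_dot_bij quotient_dotA
    quotient_dot_nondeg.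

(** The two alternatives are the two cases of simplicity for the projection onto
    the quotient by [e]. *)
Lemma simple_congruence : simple_cycle_set X ->
  (forall x y, e x y) \/ (forall x y, e x y -> x = y).
Proof.
case=> _ /(_ Q quotient_proj) [].
- by move=> x y; rewrite -quotient_dotE.
- by move=> u; exists (quotient_repr u); rewrite quotient_reprK.
- move/eqP/fintype1P => [u uP]; left=> x y.
  by apply/quotient_projE; rewrite !(uP (quotient_proj _)).
- by case=> g pK _; right=> x y /quotient_projE /(can_inj pK).
Qed.

End Congruence.

(** * Ideals of a finite left brace *)

Section Ideals.

Variable B : finLeftBraceType.
Implicit Types (a b c : B) (I J : {set B}).

Lemma circVK a b : circ (circV a) (circ a b) = b.
Proof. by rewrite circA circVx circ1E circ0x. Qed.

Lemma circKV a b : circ a (circ (circV a) b) = b.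
Proof. by rewrite circA circxV circ0x. Qed.

Lemma circVV a : circV (circV a) = a.
Proof. by rewrite -[LHS]circx0 -(circ1E B) -(circVx a) circVK. Qed.

Lemma circV_circ a b : circV (circ a b) = circ (circV b) (circV a).
Proof.
by rewrite -[RHS]circx0 -(circxV (circ a b)) -!circA !circVK.
Qed.

Lemma lambdaK a : cancel (lambda a) (lambda (circV a)).
Proof. by move=> b; rewrite -lambda_circ circVx circ1E lambda_id. Qed.

Lemma lambdaVK a : cancel (lambda (circV a)) (lambda a).
Proof. by move=> b; rewrite -lambda_circ circxV lambda_id. Qed.

Lemma add_circ a b : a + b = circ a (lambda (circV a) b).
Proof. by rewrite circ_lambda lambdaVK. Qed.

Lemma lambda_sum a n (c : 'I_n -> B) :
  lambda a (\sum_i c i) = \sum_i lambda a (c i).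
Proof. by apply: (big_morph (lambda a)); [exact: lambdaD | exact: lambda0]. Qed.

Lemma socleE a : (a \in socle B) = [forall b, lambda a b == b].
Proof.
rewrite inE; apply: eq_forallb => b.
by rewrite circ_lambda (inj_eq (addrI a)) eq_sym.
Qed.

Lemma is_idealP I : reflect
  [/\ 0 \in I, forall a b, a \in I -> b \in I -> circ a b \in I,
      forall a b, a \in I -> circ (circV b) (circ a b) \in I
    & forall a b, b \in I -> lambda a b \in I]
  (is_ideal I).
Proof.
apply: (iffP and3P) => [[/group_setP[I1 IM] /andP[_ nI] /forallP lI]|[I0 IM IJ IL]].
  split=> [|a b aI bI|a b aI|a b bI].
  - by have := I1; rewrite -[0]circ1E.
  - exact: (IM a b).
  - have := subsetP nI b (in_setT (b : circ_group B)); rewrite inE => /subsetP.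
    by apply; apply/imsetP; exists a.
  - by apply: (subsetP (lI a)); apply/imsetP; exists b.
split.
- by apply/group_setP; split=> [|a b]; [have := I0; rewrite -circ1E | exact: IM].
- apply/andP; split; first exact: subsetT.
  apply/subsetP=> b _; rewrite inE; apply/subsetP=> _ /imsetP[a aI ->].
  exact: IJ.
- by apply/forallP=> a; apply/subsetP=> _ /imsetP[b bI ->]; exact: IL.
Qed.

Lemma ideal_full : is_ideal [set: B].
Proof. by apply/is_idealP; split=> *; rewrite inE. Qed.

Lemma idealI I J : is_ideal I -> is_ideal J -> is_ideal (I :&: J).
Proof.
move=> /is_idealP[I0 IM IJ IL] /is_idealP[J0 JM JJ JL]; apply/is_idealP.
split=> [|a b|a b|a b]; rewrite ?in_setI ?I0 ?J0 //.
- by case/andP=> ? ? /andP[? ?]; rewrite IM ?JM.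
- by case/andP=> ? ?; rewrite IJ ?JJ.
- by case/andP=> ? ?; rewrite IL ?JL.
Qed.

Lemma ideal_circV I a : is_ideal I -> a \in I -> circV a \in I.
Proof.
by case/and3P=> gI _ _ aI; exact: (groupVr (G := Group gI) (x := a) aI).
Qed.

Lemma idealD I a b : is_ideal I -> a \in I -> b \in I -> a + b \in I.
Proof. by case/is_idealP=> _ IM _ IL aI bI; rewrite add_circ IM ?IL. Qed.

Lemma idealN I a : is_ideal I -> a \in I -> - a \in I.
Proof.
move=> idI aI; case/is_idealP: (idI) => _ _ _ IL.
have -> : - a = lambda a (circV a).
  by apply: (addrI a); rewrite subrr -circ_lambda circxV.
by rewrite IL ?ideal_circV.
Qed.

(** Both [circ a b] and [b + lambda b a'] are the same element when [a'] is the
    conjugate of [a] by [b]; as I is normal, lambda-invariant and additively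
    closed, the difference is a combination of elements of I. *)
Lemma ideal_lambda_sub I a b : is_ideal I -> a \in I -> lambda a b - b \in I.
Proof.
move=> idI aI; case/is_idealP: (idI) => _ _ IJ IL.
have -> : lambda a b - b = lambda b (circ (circV b) (circ a b)) - a.
  by rewrite /lambda circKV [LHS]addrC [- a + _]addrC addrA.
by rewrite idealD ?idealN ?IL ?IJ.
Qed.

Lemma minimal_ideal_exists I : is_ideal I -> I != [set 0] ->
  exists2 J, is_minimal_ideal J & J \subset I.
Proof.
move=> idI nI.
have [|J mJ sJ] := @minset_exists _ (fun J => is_ideal J && (J != [set 0])) I.
  by rewrite idI.
by exists J.
Qed.

End Ideals.

(** * Transitive cycle bases *)

Section CycleBaseTheory.

Variables (B : finLeftBraceType) (X : {set B}).
Hypothesis cbX : transitive_cycle_base X.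
Implicit Types (a b x y : B).

Lemma cycle_base_sum b :
  exists n, exists2 c : 'I_n -> B, forall i, c i \in X & b = \sum_i c i.
Proof.
case/andP: cbX => _ /eqP gX.
have : b \in <<X : {set (B : finZmodType)}>>%g by rewrite gX inE.
by case/gen_prodgP=> n [c cX ->]; exists n, c.
Qed.

Lemma lambda_cycle_base a x : x \in X -> lambda a x \in X.
Proof.
case/andP: cbX => /existsP[z /eqP->] _ /imsetP[c _ ->].
by rewrite -lambda_circ; apply: imset_f.
Qed.

(** X generates [(B, circ)] as a monoid: a sum [x + b] is the circ product of x
    with [lambda_x^-1 b], and X is lambda-invariant, so a sum of n elements of X
    is also a circ product of n elements of X. *)
Lemma cycle_base_circ_ind (P : B -> Prop) :
  P 0 -> (forall x, x \in X -> P x) ->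
  (forall a b, P a -> P b -> P (circ a b)) -> forall b, P b.
Proof.
move=> P0 PX PM b; have [n [c cX ->]] := cycle_base_sum b.
elim: n => [|n IHn] in c cX *; first by rewrite big_ord0.
rewrite big_ord_recl add_circ lambda_sum; apply: PM; first exact: PX.
by apply: IHn => i; exact: lambda_cycle_base.
Qed.

Lemma cycle_base_fix_socle a :
  (forall x, x \in X -> lambda a x = x) -> a \in socle B.
Proof.
move=> fX; rewrite socleE; apply/forallP=> b; apply/eqP.
have [n [c cX ->]] := cycle_base_sum b.
by rewrite lambda_sum; apply: eq_bigr => i _; exact: fX.
Qed.

Lemma cycle_base_singleton_socle :
  (forall x y, x \in X -> y \in X -> x = y) -> socle B = [set: B].
Proof.
move=> X1; apply/eqP; rewrite eqEsubset subsetT; apply/subsetP=> a _.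
by apply: cycle_base_fix_socle => x xX; apply: X1; rewrite ?lambda_cycle_base.
Qed.

(** An element [a] of I taking x to y shows that [y - x] is in I, and
    likewise for J. *)
Lemma disjoint_transitive_ideals I J x y : is_ideal I -> is_ideal J ->
  I :&: J = [set 0] -> acts_transitively I X -> acts_transitively J X ->
  x \in X -> y \in X -> x = y.
Proof.
move=> idI idJ IJ0 tI tJ xX yX.
have [a aI eqa] := tI x y xX yX; have [b bJ eqb] := tJ x y xX yX.
have : y - x \in I :&: J.
  by rewrite inE -{1}eqa -eqb !ideal_lambda_sub.
by rewrite IJ0 inE subr_eq0 => /eqP.
Qed.

Local Notation T := (cycle_base_type cbX).

(** The inverse of [lambda a] on X is used, rather than [lambda a] itself, so that
    the operation of the cycle set is the action of its elements; this makes it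
    a right action of [(B, circ)]. *)
Definition lambdaV_act (a : B) (t : T) : T :=
  exist _ (lambda_inv a (val t)) (lambda_inv_cycle_base cbX a (valP t)).

Lemma val_lambdaV_act a t : val (lambdaV_act a t) = lambda (circV a) (val t).
Proof. by rewrite /= lambda_invE. Qed.

Lemma cdotE (s t : T) : cdot s t = lambdaV_act (val s) t.
Proof. by []. Qed.

Lemma lambdaV_act0 t : lambdaV_act 0 t = t.
Proof.
apply/val_inj/(@lambda_inj B 0).
by rewrite val_lambdaV_act lambdaVK lambda_id.
Qed.

Lemma lambdaV_act_circ a b t :
  lambdaV_act (circ a b) t = lambdaV_act b (lambdaV_act a t).
Proof.
apply/val_inj/(@lambda_inj B (circ a b)).
by rewrite val_lambdaV_act lambdaVK lambda_circ !val_lambdaV_act !lambdaVK.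
Qed.

(** * The congruence defined by an ideal *)

Section OrbitCongruence.

Variable I : {set B}.
Hypothesis idI : is_ideal I.

Definition ideal_orbit_rel : rel T :=
  fun s t => [exists a in I, lambda a (val s) == val t].

Lemma ideal_orbitP (s t : T) :
  reflect (exists2 a, a \in I & lambda a (val s) = val t) (ideal_orbit_rel s t).
Proof.
by apply: (iffP exists_inP) => -[a aI /eqP e]; exists a => //; exact/eqP.
Qed.

Lemma ideal_orbit_equiv : equiv_class_of ideal_orbit_rel.
Proof.
case/is_idealP: (idI) => I0 IM _ _.
have sym : forall s t, ideal_orbit_rel s t -> ideal_orbit_rel t s.
  move=> s t /ideal_orbitP[a aI e]; apply/ideal_orbitP.
  by exists (circV a); rewrite ?ideal_circV // -e lambdaK.
split=> [s|s t|t s u].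
- by apply/ideal_orbitP; exists 0; rewrite ?lambda_id.
- by apply/idP/idP; exact: sym.
- move=> /ideal_orbitP[a aI ea] /ideal_orbitP[b bI eb]; apply/ideal_orbitP.
  by exists (circ b a); rewrite ?IM // lambda_circ ea eb.
Qed.

Canonical ideal_orbit_equiv_rel := EquivRelPack ideal_orbit_equiv.

(** If [s' = lambda_a s] then [s' = circ s j] with [j] in I, so acting by [s'] on
    [t' = lambda_b t] amounts to acting by [s] on [t] and then by [j^-1] times
    the conjugate of [b] by [s]. *)
Lemma ideal_orbit_cdot (s s' t t' : T) :
  ideal_orbit_rel s s' -> ideal_orbit_rel t t' ->
  ideal_orbit_rel (cdot s t) (cdot s' t').
Proof.
case/is_idealP: (idI) => I0 IM IJ IL.
move=> /ideal_orbitP[a aI ea] /ideal_orbitP[b bI eb].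
pose x := val s.
pose j := lambda (circV x) (val s' - x).
have jI : j \in I by rewrite IL // -ea ideal_lambda_sub.
have es' : val s' = circ x j by rewrite /j -add_circ addrC subrK.
apply/ideal_orbitP; exists (circ (circV j) (circ (circV x) (circ b x))).
  by rewrite IM ?IJ ?ideal_circV.
rewrite !cdotE !val_lambdaV_act; apply: (@lambda_inj B (val s')).
rewrite lambdaVK -eb es' -!lambda_circ -!circA.
by rewrite (circKV j) (circKV x) circxV circx0.
Qed.

Lemma simple_ideal_transitive : simple_cycle_set T ->
  acts_transitively I X \/ I \subset socle B.
Proof.
move=> sT; have [all_e|triv_e] :=
  @simple_congruence _ ideal_orbit_equiv_rel ideal_orbit_cdot sT.
  left=> x y xX yX.
  by have /ideal_orbitP := all_e (exist _ x xX : T) (exist _ y yX : T).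
right; apply/subsetP=> a aI; apply: cycle_base_fix_socle => x xX.
pose t : T := exist _ x xX; pose u : T := exist _ (lambda a x) (lambda_cycle_base a xX).
suff /(congr1 val) : t = u by [].
by apply: triv_e; apply/ideal_orbitP; exists a.
Qed.

End OrbitCongruence.

(** * The ideal defined by a morphism *)

Section MorphismKernel.

Variables (Y : cycleSetType) (f : T -> Y).
Hypothesis f_morph : cycle_set_morphism f.

(** The action of B descends to the image of f: for the generators X of
    [(B, circ)] this is the morphism property. *)
Lemma morphism_lambdaV_act a s t :
  f s = f t -> f (lambdaV_act a s) = f (lambdaV_act a t).
Proof.
elim/cycle_base_circ_ind: a s t => [s t|x xX s t est|a b IHa IHb s t est].
- by rewrite !lambdaV_act0.
- by rewrite -!(cdotE (exist _ x xX : T)) !f_morph est.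
- by rewrite !lambdaV_act_circ; apply/IHb/IHa.
Qed.

Definition morphism_kernel : {set B} :=
  [set a | [forall t, f (lambdaV_act a t) == f t]].

Lemma morphism_kernelP a :
  reflect (forall t, f (lambdaV_act a t) = f t) (a \in morphism_kernel).
Proof. by rewrite inE; apply: (iffP forallP) => h t; exact/eqP. Qed.

(** For [b = x] in X, the sum [x + a] is both [circ x (lambda_x^-1 a)] and
    [circ a (lambda_a^-1 x)].  If [a] is in the kernel, then [lambda_a^-1 x] has
    the same image by f as [x], hence acts as [x] does on the image of f, so
    the second product acts as [x] there; therefore [lambda_x^-1 a] acts
    trivially. *)
Lemma morphism_kernel_lambdaV a b :
  a \in morphism_kernel -> lambda (circV b) a \in morphism_kernel.
Proof.
elim/cycle_base_circ_ind: b a => [a|x xX a /morphism_kernelP aK|b c IHb IHc a aK].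
- by rewrite -[circV 0]circ0x circxV lambda_id.
- pose s : T := exist _ x xX.
  have act_s t : f (lambdaV_act (circ x (lambda (circV x) a)) t)
                 = f (lambdaV_act x t).
    rewrite -add_circ addrC add_circ lambdaV_act_circ.
    rewrite -(val_lambdaV_act a s) -cdotE f_morph !aK.
    by rewrite -(f_morph s).
  apply/morphism_kernelP=> t.
  by have := act_s (lambdaV_act (circV x) t);
    rewrite -!lambdaV_act_circ circA circVx circ1E circ0x lambdaV_act0.
- rewrite circV_circ lambda_circ; exact/IHc/IHb.
Qed.

Lemma morphism_kernel_ideal : is_ideal morphism_kernel.
Proof.
apply/is_idealP; split=> [|a b /morphism_kernelP aK /morphism_kernelP bK|
    a b /morphism_kernelP aK|a b bK].
- by apply/morphism_kernelP=> t; rewrite lambdaV_act0.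
- by apply/morphism_kernelP=> t; rewrite lambdaV_act_circ bK aK.
- apply/morphism_kernelP=> t; rewrite !lambdaV_act_circ.
  have /(morphism_lambdaV_act b) -> := aK (lambdaV_act (circV b) t).
  by rewrite -lambdaV_act_circ circVx circ1E lambdaV_act0.
- by rewrite -[a]circVV; exact: morphism_kernel_lambdaV.
Qed.

(** Two elements of X with the same image by f act in the same way on the image
    of f, so their circ quotient lies in the kernel. *)
Lemma morphism_kernel_trivial_inj : morphism_kernel = [set 0] -> injective f.
Proof.
move=> K0 s t est; apply: val_inj.
suff : circ (val s) (circV (val t)) \in morphism_kernel.
  rewrite K0 inE => /eqP e.
  by rewrite -[LHS]circx0 -(circ1E B) -(circVx (val t)) circA e circ0x.
apply/morphism_kernelP=> u; rewrite lambdaV_act_circ.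
have -> : f (lambdaV_act (circV (val t)) (lambdaV_act (val s) u))
       = f (lambdaV_act (circV (val t)) (lambdaV_act (val t) u)).
  by apply: morphism_lambdaV_act; rewrite -!cdotE !f_morph est.
by rewrite -lambdaV_act_circ circxV lambdaV_act0.
Qed.

Lemma morphism_kernel_transitive_const :
  acts_transitively morphism_kernel X -> forall s t, f s = f t.
Proof.
move=> tK s t.
have [a /morphism_kernelP aK ea] := tK _ _ (valP t) (valP s).
rewrite -(aK s); congr (f _); apply: val_inj.
by rewrite val_lambdaV_act -ea lambdaK.
Qed.

End MorphismKernel.

End CycleBaseTheory.

(** * Simplicity and the ideals of the brace *)

Theorem theorem12 (B : finLeftBraceType) (cardB : (1 < #|B|)%N)
    (socB : socle B = [set 0]) (X : {set B}) (cbX : transitive_cycle_base X) :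
  (simple_cycle_set (cycle_base_type cbX) <->
     (forall I : {set B}, is_ideal I -> I <> [set 0] -> acts_transitively I X))
  /\
  ((forall I : {set B}, is_ideal I -> I <> [set 0] -> acts_transitively I X) <->
     (exists I : {set B},
        [/\ is_minimal_ideal I,
            forall J : {set B}, is_minimal_ideal J -> J = I
          & acts_transitively I X])).
Proof.
have socF : socle B <> [set: B].
  by rewrite socB => /(congr1 (fun A : {set B} => #|A|)) e;
    rewrite cards1 cardsT in e; rewrite -e in cardB.
have full0 : [set: B] != [set 0] by rewrite -socB eq_sym; exact/eqP.
split; split.
- move=> sX I idI I0; case: (simple_ideal_transitive idI sX) => // IS.
  case: I0; apply/eqP; rewrite eqEsubset -{1}socB IS sub1set.
  by case/is_idealP: idI.
- move=> tI; split.
    rewrite ltnNge; apply/negP=> /card_le1_eqP X1; apply: socF.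
    apply: (cycle_base_singleton_socle cbX) => x y xX yX.
    exact: (congr1 val (X1 (exist _ y yX : cycle_base_type cbX)
                          (exist _ x xX : cycle_base_type cbX) isT isT)).
  move=> Y f f_morph f_surj.
  have idK := morphism_kernel_ideal f_morph.
  have [K0|/eqP K0] := eqVneq (morphism_kernel f) [set 0].
    right; have injf := morphism_kernel_trivial_inj f_morph K0.
    apply: inj_card_bij => //; rewrite -(card_codom injf).
    apply: subset_leq_card; apply/subsetP=> y _.
    by have [x <-] := f_surj y; exact: codom_f.
  left; apply/eqP/fintype1P.
  have const_f := morphism_kernel_transitive_const (tI _ idK K0).
  have /card_gt0P[x0 _] := cycle_base_gt0 cbX.
  by exists (f x0) => y; have [x <-] := f_surj y; exact: const_f.
- move=> tI.
  have [I mI _] := minimal_ideal_exists (ideal_full B) full0.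
  have min_props (J : {set B}) : is_minimal_ideal J -> is_ideal J /\ J <> [set 0].
    by case/minsetP=> /andP[-> /eqP].
  have [idI I0] := min_props I mI.
  exists I; split=> // [J mJ|]; last exact: tI.
  have [idJ J0] := min_props J mJ.
  have [IJ0|IJ0] := eqVneq (I :&: J) [set 0].
    case: socF; apply: (cycle_base_singleton_socle cbX) => x y.
    exact: (disjoint_transitive_ideals idI idJ IJ0 (tI I _ _) (tI J _ _)).
  have idIJ := idealI idI idJ.
  have eI : I :&: J = I.
    by case/minsetP: mI => _; apply; rewrite ?subsetIl // idIJ.
  by case/minsetP: mJ => _ minJ; rewrite -eI; apply/esym/minJ; rewrite ?subsetIr ?idIJ.
- case=> I [_ uI tI] J idJ /eqP J0 x y xX yX.
  have [K mK sKJ] := minimal_ideal_exists idJ J0.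
  have [a aI e] := tI x y xX yX; exists a => //.
  by apply: (subsetP sKJ); rewrite (uI K mK).
Qed.
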